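(* Every polynomial identity of degree $\le 5$ for the trilinear operation $(x,y,z)=\beta(x\wedge y)\cdot z$ on the $\mathfrak{sl}(2,\mathbb{C})$-module $V(6)$ is a consequence of skew-symmetry $(a,b,c)+(b,a,c)\equiv 0$ and the ternary derivation identity $$((a,b,c),d,e)-((a,b,d),c,e)-(a,b,(c,d,e))+(c,d,(a,b,e))\equiv 0.$$
   Context: $V(6)$ is the 7-dimensional irreducible $\mathfrak{sl}(2,\mathbb{C})$-module with basis $v_6,v_4,v_2,v_0,v_{-2},v_{-4},v_{-6}$ of $H$-eigenvectors, where $H\cdot v_{6-2i}=(6-2i)v_{6-2i}$, $E\cdot v_{6-2i}=(7-i)v_{6-2(i-1)}$, $F\cdot v_{6-2i}=(i+1)v_{6-2(i+1)}$ (with $v_8=v_{-8}=0$). Here $H,E,F$ is the standard basis of $\mathfrak{sl}(2,\mathbb{C})$, with $[H,E]=2E$, $[H,F]=-2F$, $[E,F]=H$. The map $\beta\colon\Lambda^2V(6)\to V(2)\approx\mathfrak{sl}(2,\mathbb{C})$ is the (unique up to nonzero scalar) nonzero $\mathfrak{sl}(2,\mathbb{C})$-module morphism. With $u_2=-E$, $u_0=H$, $u_{-2}=F$ it is normalized by $\beta(v_6\wedge v_{-4})=2u_2$, $\beta(v_6\wedge v_{-6})=u_0$, $\beta(v_4\wedge v_{-2})=-10u_2$, $\beta(v_4\wedge v_{-4})=-4u_0$, $\beta(v_4\wedge v_{-6})=2u_{-2}$, $\beta(v_2\wedge v_0)=20u_2$, $\beta(v_2\wedge v_{-2})=5u_0$,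 $\beta(v_2\wedge v_{-4})=-10u_{-2}$, $\beta(v_0\wedge v_{-2})=20u_{-2}$, and $\beta(v_p\wedge v_q)=0$ for all other $p>q$. The dot in $\beta(x\wedge y)\cdot z$ is the action of $\mathfrak{sl}(2,\mathbb{C})$ on $V(6)$. A polynomial identity of degree $\le n$ is a nonassociative polynomial over $\mathbb{C}$ of degree $\le n$ in the given operation which vanishes for all substitutions of elements of $V(6)$ for the variables. An identity is a consequence of a set of identities if it is satisfied by every vector space over $\mathbb{C}$ with a trilinear operation satisfying all identities in the set. *)

(* Defs.v *)
From HB Require Import structures.
From mathcomp Require Import all_boot all_order all_algebra.
From mathcomp Require Import finmap ring.
From mathcomp.multinomials Require Import monalg.

Set Implicit Arguments.
Unset Strict Implicit.
Unset Printing Implicit Defensive.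

Import GRing.Theory.
Local Open Scope ring_scope.

(* The free ternary magma on the variables x_0, x_1, ... *)
Inductive tmon : Type :=
| Var of nat
| Op of tmon & tmon & tmon.

Fixpoint tmon_tree (m : tmon) : GenTree.tree nat :=
  match m with
  | Var i => GenTree.Leaf i
  | Op m1 m2 m3 => GenTree.Node 0 [:: tmon_tree m1; tmon_tree m2; tmon_tree m3]
  end.

Fixpoint tree_tmon (t : GenTree.tree nat) : tmon :=
  match t with
  | GenTree.Leaf i => Var i
  | GenTree.Node _ [:: t1; t2; t3] =>
      Op (tree_tmon t1) (tree_tmon t2) (tree_tmon t3)
  | _ => Var 0
  end.

Lemma tmon_treeK : cancel tmon_tree tree_tmon.
Proof. by elim=> //= m1 -> m2 -> m3 ->. Qed.

HB.instance Definition _ := Choice.copy tmon (can_type tmon_treeK).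

Fixpoint tmon_deg (m : tmon) : nat :=
  match m with
  | Var _ => 1
  | Op m1 m2 m3 => tmon_deg m1 + tmon_deg m2 + tmon_deg m3
  end.

(* Nonassociative polynomials in one ternary operation: the free K-module on
   the ternary monomials. *)
Notation tpoly K := {malg K[tmon]}.

Section Identities.
Variable K : fieldType.

Definition deg_le (n : nat) (f : tpoly K) : Prop :=
  forall m, m \in msupp f -> (tmon_deg m <= n)%N.

Section Evaluation.
Variables (V : lmodType K) (op : V -> V -> V -> V).

Definition trilinear : Prop :=
  [/\ forall y z, linear (fun x => op x y z),
      forall x z, linear (fun y => op x y z)
    & forall x y, linear (fun z => op x y z)].

Fixpoint tmon_eval (s : nat -> V) (m : tmon) : V :=
  match m with
  | Var i => s i
  | Op m1 m2 m3 => op (tmon_eval s m1) (tmon_eval s m2) (tmon_eval s m3)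
  end.

Definition tpoly_eval (s : nat -> V) (f : tpoly K) : V :=
  \sum_(m <- msupp f) f@_m *: tmon_eval s m.

Definition satisfies (f : tpoly K) : Prop :=
  forall s : nat -> V, tpoly_eval s f = 0.

End Evaluation.

Definition consequence (S : seq (tpoly K)) (f : tpoly K) : Prop :=
  forall (V : lmodType K) (op : V -> V -> V -> V),
    trilinear op -> (forall g, g \in S -> satisfies op g) -> satisfies op f.

Definition skew_symmetry : tpoly K :=
  let a := Var 0 in let b := Var 1 in let c := Var 2 in
  << Op a b c >> + << Op b a c >>.

Definition ternary_derivation : tpoly K :=
  let a := Var 0 in let b := Var 1 in let c := Var 2 in
  let d := Var 3 in let e := Var 4 in
  << Op (Op a b c) d e >> - << Op (Op a b d) c e >>
    - << Op a b (Op c d e) >> + << Op c d (Op a b e) >>.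

End Identities.

Section Sl2.
Variable K : fieldType.

(* sl(2,K) is realized as the trace-zero 2 x 2 matrices. *)
Definition sl2H : 'M[K]_2 := delta_mx 0 0 - delta_mx 1 1.
Definition sl2E : 'M[K]_2 := delta_mx 0 1.
Definition sl2F : 'M[K]_2 := delta_mx 1 0.

Lemma sl2_decomp (X : 'M[K]_2) : \tr X = 0 ->
  X = X 0 0 *: sl2H + X 0 1 *: sl2E + X 1 0 *: sl2F.
Proof.
move/eqP; rewrite /mxtrace !big_ord_recl big_ord0 addr0 addrC addr_eq0.
rewrite (_ : lift _ _ = 1); last exact: val_inj.
move=> /eqP X11; apply/matrixP => i j; rewrite !mxE.
have ord2 (k : 'I_2) : k = 0 \/ k = 1.
  by case: k => [[|[|//]] hk]; [left | right]; exact: val_inj.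
by case: (ord2 i) => ->; case: (ord2 j) => -> /=; rewrite ?X11; ring.
Qed.

(* Elements of V(6) are column vectors; coordinate i is that of v_(6-2i). *)
Definition V6 : lmodType K := 'cV[K]_7.

Definition V6H : 'M[K]_7 :=
  \matrix_(k, i) (if k == i then 6 - 2 * i%:R else 0).
Definition V6E : 'M[K]_7 :=
  \matrix_(k, i) (if i == k.+1 :> nat then 7 - i%:R else 0).
Definition V6F : 'M[K]_7 :=
  \matrix_(k, i) (if k == i.+1 :> nat then i%:R + 1 else 0).

(* Only meaningful on trace-zero matrices, see sl2_decomp. *)
Definition V6_rep (X : 'M[K]_2) : 'M[K]_7 :=
  X 0 0 *: V6H + X 0 1 *: V6E + X 1 0 *: V6F.

Definition V6_act (X : 'M[K]_2) (z : V6) : V6 := V6_rep X *m z.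

(* The exterior square of V(6) is realized as the space of skew-symmetric 7 x 7
   matrices: for p < q, v_(6-2p) /\ v_(6-2q) is the one whose entries above the
   diagonal are 0 except for a 1 at (p, q). *)
Definition wedge (x y : V6) : 'M[K]_7 := x *m y^T - y *m x^T.

Definition u2 : 'M[K]_2 := - sl2E.
Definition u0 : 'M[K]_2 := sl2H.
Definition um2 : 'M[K]_2 := sl2F.

(* The value of beta on v_(6-2i) /\ v_(6-2j), for i < j. *)
Definition beta_basis (i j : nat) : 'M[K]_2 :=
  match i, j with
  | 0%N, 5%N => 2 *: u2
  | 0%N, 6%N => u0
  | 1%N, 4%N => - 10 *: u2
  | 1%N, 5%N => - 4 *: u0
  | 1%N, 6%N => 2 *: um2
  | 2%N, 3%N => 20 *: u2
  | 2%N, 4%N => 5 *: u0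
  | 2%N, 5%N => - 10 *: um2
  | 3%N, 4%N => 20 *: um2
  | _, _ => 0
  end.

Definition beta (w : 'M[K]_7) : 'M[K]_2 :=
  \sum_(i < 7) \sum_(j < 7 | (i < j)%N) w i j *: beta_basis i j.

(* v_(6-2i) *)
Definition v6 (i : 'I_7) : V6 := delta_mx i 0.

Lemma mul_v6 (A : 'M[K]_7) (i k : 'I_7) : (A *m v6 i) k 0 = A k i.
Proof. by rewrite -colE mxE. Qed.

Lemma V6_rep_basis :
  [/\ V6_rep sl2H = V6H, V6_rep sl2E = V6E & V6_rep sl2F = V6F].
Proof.
by split; rewrite /V6_rep !mxE /= ?subr0 ?sub0r ?scale1r ?scale0r ?addr0 ?add0r.
Qed.

Lemma V6H_v6 (i : 'I_7) : V6_act sl2H (v6 i) = (6 - 2 * i%:R) *: v6 i.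
Proof.
rewrite /V6_act; have [-> _ _] := V6_rep_basis.
apply/matrixP => k l; rewrite (ord1 l) mul_v6 !mxE andbT.
by case: eqP => _; rewrite ?mulr1 ?mulr0.
Qed.

Lemma V6E_v6 (i j : 'I_7) : i = j.+1 :> nat ->
  V6_act sl2E (v6 i) = (7 - i%:R) *: v6 j.
Proof.
rewrite /V6_act; have [_ -> _] := V6_rep_basis.
move=> ij; apply/matrixP => k l; rewrite (ord1 l) mul_v6 !mxE andbT.
by rewrite {1}ij eqSS eq_sym val_eqE; case: eqP => _; rewrite ?mulr1 ?mulr0.
Qed.

Lemma V6E_v6_0 : V6_act sl2E (v6 0) = 0.
Proof.
rewrite /V6_act; have [_ -> _] := V6_rep_basis.
by apply/matrixP => k l; rewrite (ord1 l) mul_v6 !mxE.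
Qed.

Lemma V6F_v6 (i j : 'I_7) : j = i.+1 :> nat ->
  V6_act sl2F (v6 i) = (i%:R + 1) *: v6 j.
Proof.
rewrite /V6_act; have [_ _ ->] := V6_rep_basis.
move=> ji; apply/matrixP => k l; rewrite (ord1 l) mul_v6 !mxE andbT.
by rewrite -ji val_eqE; case: eqP => _; rewrite ?mulr1 ?mulr0.
Qed.

Lemma V6F_v6_6 : V6_act sl2F (v6 ord_max) = 0.
Proof.
rewrite /V6_act; have [_ _ ->] := V6_rep_basis.
apply/matrixP => k l; rewrite (ord1 l) mul_v6 !mxE.
by rewrite (ltn_eqF (ltn_ord k)).
Qed.

Lemma beta_v6 (i j : 'I_7) : (i < j)%N ->
  beta (wedge (v6 i) (v6 j)) = beta_basis i j.
Proof.
move=> lij; have nij : (i == j) = false by rewrite -val_eqE (ltn_eqF lij).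
rewrite /beta /wedge !trmx_delta !mul_delta_mx.
rewrite (bigD1 i) //= (bigD1 j) //= big1 => [|l /andP[_ lj]].
  rewrite big1 => [|k ki].
    by rewrite !mxE !eqxx nij /= subr0 scale1r !addr0.
  rewrite big1 // => l kl; rewrite !mxE (negPf ki) /=.
  case: eqP => [kj|_]; last by rewrite subr0 scale0r.
  case: eqP => [li|_]; last by rewrite subr0 scale0r.
  by move: kl; rewrite kj li ltnNge (ltnW lij).
by rewrite !mxE eqxx (negPf lj) nij /= subr0 scale0r.
Qed.

Lemma beta_tr (w : 'M[K]_7) : \tr (beta w) = 0.
Proof.
rewrite /beta raddf_sum big1 // => i _; rewrite raddf_sum big1 // => j _ /=.
have tr_delta (p q : 'I_2) : \tr (delta_mx p q : 'M[K]_2) = (p == q)%:R.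
  rewrite /mxtrace (bigD1 p) //= big1 ?addr0 ?mxE ?eqxx // => k kp.
  by rewrite mxE (negPf kp).
have tr0 : (\tr u2 = 0) * (\tr u0 = 0) * (\tr um2 = 0).
  by rewrite /u2 /u0 /um2 linearN linearB /= !tr_delta /= subrr oppr0.
have tr_basis p q : \tr (beta_basis p q) = 0.
  case: p => [|[|[|[|p]]]]; case: q => [|[|[|[|[|[|[|q]]]]]]] //=;
  by rewrite ?linearZ /= ?tr0 ?mulr0 ?mxtrace0.
by rewrite mxtraceZ tr_basis mulr0.
Qed.

Definition V6_op (x y z : V6) : V6 := V6_act (beta (wedge x y)) z.

End Sl2.

(* Main.v *)
From HB Require Import structures.
Require Import Defs.
From mathcomp Require Import all_boot all_order all_algebra.
From mathcomp Require Import finmap ring zify.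
From mathcomp Require Import reals.
From mathcomp.real_closed Require Import complex.
From mathcomp.multinomials Require Import monalg.

Set Implicit Arguments.
Unset Strict Implicit.
Unset Printing Implicit Defensive.

Import GRing.Theory Num.Theory.
Local Open Scope ring_scope.

(** Monomials of degree at most 5 have degree 1, 3 or 5, and replacing the
    variables by t times their values scales these three parts of an identity
    by t, t^3 and t^5; hence each part is an identity by itself, and can be
    treated alone (homogeneous_parts_eq0, tpoly_eval_parts).

    Consider degree 5. Skew-symmetry turns (x, (y, z, u), v) into
    - ((y, z, u), x, v), and the derivation identity expresses the part of
    ((x, y, z), u, v) that is skew in z and u through products of the form
    (x, y, (z, u, v)). So, modulo the two identities, every polynomial of
    degree 5 is a combination of
      S(x, y, z, u, v) = ((x, y, z), u, v) + ((x, y, u), z, v)  and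
      B(x, y, z, u, v) = (x, y, (z, u, v))
    (normal_form5). S is skew in x, y and symmetric in z, u; B is skew in x, y
    and in z, u. The triple product of V(6) itself satisfies the two
    identities, because H, E and F act on it as derivations
    (V6_op_derivation), so an identity of V(6) may be brought to this form.

    It remains to see that S and B satisfy on V(6) no linear relation besides
    those forced by their symmetries. Polarization reduces this to
    multilinear relations, one for each word of variables, and a single
    evaluation at weight vectors is nearly enough. At
    (v_6, v_-4, v_0, v_0, v_-6), permuted in all ways, B always vanishes and
    S survives only under the four permutations coming from its symmetries:
    hence the signed sum of the coefficients of S over its symmetries is zero,
    which makes the S-part vanish in every algebra satisfying the two
    identities. What is left is a combination of B alone, and two further
    evaluations finish it (transfer5). In degrees 3 and 1 one evaluation
    suffices (transfer3, transfer1).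

    Relations are moved from V(6) to an arbitrary algebra by coef_relation,
    which extracts linear relations between coefficients from evaluations, and
    signed_sum_eq0, which turns these into the vanishing of a sum. *)

(** * Words and multilinear functions *)

Fixpoint words (r : seq nat) (n : nat) : seq (seq nat) :=
  if n is k.+1 then [seq i :: w | i <- r, w <- words r k] else [:: [::]].

Lemma mem_words r n w : (w \in words r n) = (size w == n) && all (mem r) w.
Proof.
elim: n w => [|n IHn] [|i w] //=.
  by apply/negbTE/negP => /allpairsP [[j x] /= [_ _]].
apply/allpairsP/idP => [[[j x] /= [jr xr [-> ->]]]|].
  by move: xr; rewrite IHn eqSS jr => /andP[-> ->].
rewrite eqSS => /and3P[sw ir wr]; exists (i, w); split=> //=.
by rewrite IHn sw wr.
Qed.

Lemma size_words r n w : w \in words r n -> size w = n.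
Proof. by rewrite mem_words => /andP[/eqP]. Qed.

Lemma words_uniq r n : uniq r -> uniq (words r n).
Proof.
move=> ur; elim: n => [|n IHn] //=; apply: allpairs_uniq => //.
by move=> [i x] [j y] _ _ [-> ->].
Qed.

Lemma position_lt n g i : g \in words (iota 0 n) n -> i \in g -> (i < n)%N.
Proof.
rewrite mem_words => /andP[_ /allP gn] /gn /=.
by rewrite mem_iota.
Qed.

(** Permutations of positions are represented by the words on 0, ..., n-1 in
    which every letter occurs, so that those can be listed by words. *)
Definition rearrange (w g : seq nat) : seq nat := [seq nth 0%N w i | i <- g].

Lemma rearrange_words r n u g : u \in words r n -> g \in words (iota 0 n) n ->
  rearrange u g \in words r n.
Proof.
move=> uW gW; rewrite mem_words size_map (size_words gW) eqxx all_map.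
apply/allP => i /(position_lt gW) lti /=; move: uW.
rewrite mem_words => /andP[/eqP su /allP ur].
by apply: ur; rewrite mem_nth ?su.
Qed.

Lemma map_rearrange (T : Type) (x : nat -> T) x0 w n g : size w = n ->
  g \in words (iota 0 n) n ->
  map x (rearrange w g) = [seq nth x0 (map x w) i | i <- g].
Proof.
move=> sw gW; rewrite -map_comp; apply/eq_in_map => i /(position_lt gW) lti /=.
by rewrite (nth_map 0%N) ?sw.
Qed.

Lemma big_rearrange (W : nmodType) r n g (F : seq nat -> W) : uniq r ->
  perm_eq g (iota 0 n) ->
  \sum_(w <- words r n) F w = \sum_(w <- words r n) F (rearrange w g).
Proof.
move=> ur pg; rewrite -(big_map (rearrange^~ g) xpredT F); apply: perm_big.
have gW : g \in words (iota 0 n) n.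
  rewrite mem_words (perm_size pg) size_iota eqxx /=.
  by apply/allP => i; rewrite (perm_mem pg).
have um : uniq [seq rearrange w g | w <- words r n].
  rewrite map_inj_in_uniq ?words_uniq // => w1 w2 w1W w2W eqw.
  apply: (@eq_from_nth _ 0%N) => [|i]; rewrite (size_words w1W) //.
    by rewrite (size_words w2W).
  move=> lti; have ig : i \in g by rewrite (perm_mem pg) mem_iota.
  have /(congr1 (nth 0%N ^~ (index i g))) := eqw.
  by rewrite !(nth_map 0%N) ?index_mem // nth_index.
have sub : {subset [seq rearrange w g | w <- words r n] <= words r n}.
  by move=> _ /mapP[w wW ->]; apply: rearrange_words.
rewrite perm_sym; apply: uniq_perm; rewrite ?words_uniq //.
by have [] := uniq_min_size um sub (eq_leq (esym (size_map _ _))).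
Qed.

Section Multilinear.
Variables (K : fieldType) (V : lmodType K).

(** Arguments are sequences rather than tuples, so that the same word can index
    monomials, evaluations and permutations; only the values of M on sequences
    of size n matter. *)
Definition multilinear (n : nat) (M : seq V -> V) : Prop :=
  forall s1 s2, (size s1 + size s2).+1 = n ->
    linear (fun x => M (s1 ++ x :: s2)).

Lemma multilinear_expand n (M : seq V -> V) (J : seq nat)
    (b : nat -> nat -> K) (y x : nat -> V) (s : seq V) (w : seq nat) :
  multilinear n M -> (size s + size w)%N = n ->
  (forall j, x j = \sum_(i <- J) b j i *: y i) ->
  M (s ++ map x w) = \sum_(p <- words J (size w))
     (\prod_(q <- zip w p) b q.1 q.2) *: M (s ++ map y p).
Proof.
move=> mM + xE; elim: w s => [|j w IHw] s /= sn.
  by rewrite big_seq1 big_nil scale1r.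
have sw : (size s + size (map x w)).+1 = n by rewrite size_map -sn addnS.
pose F := GRing.isLinear.Build K V V *:%R _ (mM s (map x w) sw).
pose L : {linear V -> V} := HB.pack (fun z => M (s ++ z :: map x w)) F.
rewrite -[LHS]/(L (x j)) xE linear_sum big_allpairs_dep; apply: eq_bigr => i _.
rewrite linearZ /= -cat_rcons IHw ?size_rcons ?addSnnS // scaler_sumr.
apply: eq_bigr => p _.
by rewrite big_cons /= scalerA -cat_rcons.
Qed.

(** Setting t i to zero kills exactly the terms p in which i occurs, so that
    subtracting the result removes the terms that miss i, one i at a time. This
    replaces the extraction of the multilinear coefficient in t. *)
Lemma onto_part (L : seq (seq nat)) (C : seq nat -> V) (l : seq nat) :
  (forall t : nat -> K, \sum_(p <- L) (\prod_(i <- p) t i) *: C p = 0) ->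
  \sum_(p <- L | all (mem p) l) C p = 0.
Proof.
move=> H.
suff: forall t : nat -> K,
    \sum_(p <- L | all (mem p) l) (\prod_(i <- p) t i) *: C p = 0.
  move=> /(_ (fun=> 1)) H1; rewrite -[RHS]H1; apply: eq_bigr => p _.
  by rewrite big1 // scale1r.
elim: l => [|i l IHl] t //=.
pose t0 j := if j == i then 0 else t j.
transitivity (\sum_(p <- L | all (mem p) l) (\prod_(j <- p) t j) *: C p -
              \sum_(p <- L | all (mem p) l) (\prod_(j <- p) t0 j) *: C p);
  last by rewrite !IHl subrr.
rewrite -sumrB (eq_bigl (fun p => (i \in p) && all (mem p) l)) // big_mkcondl.
apply: eq_bigr => p _; case: ifP => ip.
  by rewrite [X in _ - X *: _](big_rem i) //= /t0 eqxx mul0r scale0r subr0.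
rewrite [X in _ - X *: _](eq_big_seq t) ?subrr // => j jp.
by rewrite /t0; case: eqP => // eji; rewrite -eji jp in ip.
Qed.

(** Every variable j is replaced by the generic combination of those y i with
    u_i = j, with weights t. The terms in which each weight occurs are the ones
    in which the y i are substituted in some order p, for the word u read in the
    same order; onto_part isolates them. No multiplicities of repeated letters
    of u enter, since p runs through all permutations of positions. *)
Lemma polarization n (r : seq nat) (D : seq nat -> seq V -> V)
    (u : seq nat) (y : nat -> V) :
  uniq r -> (forall w, multilinear n (D w)) ->
  (forall x : nat -> V, \sum_(w <- words r n) D w (map x w) = 0) ->
  u \in words r n ->
  \sum_(p <- words (iota 0 n) n | all (mem p) (iota 0 n))
     D (rearrange u p) (map y p) = 0.
Proof.
move=> ur mD D0 uW; apply: onto_part => t.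
rewrite -[RHS](D0 (fun j => \sum_(i <- iota 0 n)
   (t i * (nth 0%N u i == j)%:R) *: y i)).
pose prd (w p : seq nat) : K :=
  \prod_(q <- zip w p) (t q.2 * (nth 0%N u q.2 == q.1)%:R).
have expand w : w \in words r n -> D w (map (fun j => \sum_(i <- iota 0 n)
   (t i * (nth 0%N u i == j)%:R) *: y i) w) =
   \sum_(p <- words (iota 0 n) n) prd w p *: D w (map y p).
  move=> wW; have sw := size_words wW.
  by rewrite -[map _ w]cat0s (multilinear_expand (mD w) _ (fun=> erefl)) sw.
rewrite [RHS](eq_big_seq _ expand) exchange_big /=; apply: eq_big_seq => p pW.
have prdE w : size w = size p ->
    prd w p = (\prod_(i <- p) t i) * (rearrange u p == w)%:R.
  rewrite /prd; elim: {pW} p w => [|i p IHp] [|j w] //=.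
    by rewrite !big_nil mul1r.
  move=> [sw]; rewrite !big_cons IHp //= eqseq_cons mulrACA -natrM.
  by case: eqP => //= _; case: eqP.
have upW := rearrange_words uW pW.
rewrite (bigD1_seq _ upW) ?words_uniq //= [X in _ = _ + X]big1_seq => [|w].
  by rewrite addr0 prdE ?size_map // eqxx mulr1.
case/andP; rewrite eq_sym => nw wW.
by rewrite prdE ?(size_words pW) ?(size_words wW) // (negPf nw) mulr0 scale0r.
Qed.

End Multilinear.

#[local] Arguments words : simpl never.

Section LinearMaps.
Variables (K : fieldType) (U W : lmodType K) (f : U -> W).
Hypothesis lf : linear f.

Lemma linear_zero : f 0 = 0.
Proof. by have := lf (-1) 0 0; rewrite scaler0 add0r scaleN1r addNr. Qed.

Lemma linear_scale a x : f (a *: x) = a *: f x.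
Proof. by rewrite -[_ *: x]addr0 lf linear_zero addr0. Qed.

Lemma linear_opp x : f (- x) = - f x.
Proof. by rewrite -scaleN1r linear_scale scaleN1r. Qed.

End LinearMaps.

(** * Multilinear monomials of degree three and five *)

Section Monomials.
Variables (K : fieldType) (V : lmodType K) (op : V -> V -> V -> V).

Definition mul1 (s : seq V) : V := s`_0.
Definition mul3 (s : seq V) : V := op s`_0 s`_1 s`_2.
Definition mul5l (s : seq V) : V := op (op s`_0 s`_1 s`_2) s`_3 s`_4.
Definition mul5m (s : seq V) : V := op s`_0 (op s`_1 s`_2 s`_3) s`_4.
Definition mul5r (s : seq V) : V := op s`_0 s`_1 (op s`_2 s`_3 s`_4).
Definition sym5l (s : seq V) : V :=
  mul5l s + op (op s`_0 s`_1 s`_3) s`_2 s`_4.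

Hypothesis op_tri : trilinear op.

Lemma mul1_multilinear : multilinear 1 mul1.
Proof. by move=> [|x0 s1] s2. Qed.

Lemma mul3_multilinear : multilinear 3 mul3.
Proof.
have [op1 op2 op3] := op_tri.
move=> [|x0 [|x1 [|x2 s1]]] s2 //= _ a u v; rewrite /mul3 /=;
  by rewrite (op1, op2, op3).
Qed.

Lemma mul5l_multilinear : multilinear 5 mul5l.
Proof.
have [op1 op2 op3] := op_tri.
move=> [|x0 [|x1 [|x2 [|x3 [|x4 s1]]]]] s2 //= _ a u v; rewrite /mul5l /=;
  by rewrite !(op1, op2, op3).
Qed.

Lemma mul5m_multilinear : multilinear 5 mul5m.
Proof.
have [op1 op2 op3] := op_tri.
move=> [|x0 [|x1 [|x2 [|x3 [|x4 s1]]]]] s2 //= _ a u v; rewrite /mul5m /=;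
  by rewrite !(op1, op2, op3).
Qed.

Lemma mul5r_multilinear : multilinear 5 mul5r.
Proof.
have [op1 op2 op3] := op_tri.
move=> [|x0 [|x1 [|x2 [|x3 [|x4 s1]]]]] s2 //= _ a u v; rewrite /mul5r /=;
  by rewrite !(op1, op2, op3).
Qed.

Lemma sym5l_multilinear : multilinear 5 sym5l.
Proof.
have [op1 op2 op3] := op_tri.
move=> [|x0 [|x1 [|x2 [|x3 [|x4 s1]]]]] s2 //= _ a u v;
  rewrite /sym5l /mul5l /=;
  by rewrite !(op1, op2, op3) scalerDr addrACA.
Qed.

Definition leibniz_defect (T : V -> V) (s : seq V) : V :=
  T (mul3 s) - (op (T s`_0) s`_1 s`_2 + op s`_0 (T s`_1) s`_2
                + op s`_0 s`_1 (T s`_2)).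

Lemma leibniz_defect_multilinear T :
  linear T -> multilinear 3 (leibniz_defect T).
Proof.
have [op1 op2 op3] := op_tri.
move=> TE [|x0 [|x1 [|x2 s1]]] s2 //= _ a u v; rewrite /leibniz_defect /mul3 /=;
  rewrite !(TE, op1, op2, op3) scalerBr !scalerDr;
  by rewrite [X in - (X + _)]addrACA [X in - X]addrACA opprD addrACA.
Qed.

End Monomials.

Lemma multilinear_comb (K : fieldType) (V : lmodType K) n
    (M N : seq V -> V) a b :
  multilinear n M -> multilinear n N ->
  multilinear n (fun s => a *: M s + b *: N s).
Proof.
move=> mM mN s1 s2 sn c u v; rewrite mM // mN // !scalerDr !scalerA.
by rewrite (mulrC a) (mulrC b) addrACA.
Qed.

(** * The triple product on weight vectors *)

Section WeightVectors.
Variable K : numFieldType.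
Local Notation V := (V6 K).
Local Notation op := (@V6_op K).

(** Indexing by nat rather than by 'I_7, with wv i = 0 out of range, makes the
    multiplication table V6_op_wv total. *)
Definition wv (i : nat) : V := \col_(k < 7) (k == i :> nat)%:R.

Lemma wv_ge7 i : (7 <= i)%N -> wv i = 0.
Proof.
move=> le7i; apply/matrixP => k l; rewrite !mxE ltn_eqF //.
exact: leq_trans (ltn_ord k) le7i.
Qed.

Lemma wv_ord (i : 'I_7) : wv i = v6 K i.
Proof. by apply/matrixP => k l; rewrite !mxE (ord1 l) andbT. Qed.

Lemma V6_act_linear (X : 'M[K]_2) : linear (V6_act X : V -> V).
Proof. by move=> a u v; rewrite /V6_act mulmxDr -scalemxAr. Qed.

Lemma V6_act_linearl (z : V) : linear (fun X : 'M[K]_2 => V6_act X z).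
Proof.
move=> a X Y; rewrite /V6_act /V6_rep !mxE scalemxAl -mulmxDl; congr (_ *m _).
rewrite !scalerDr !scalerDl !scalerA.
by rewrite [RHS]addrACA [X in _ = X + _]addrACA.
Qed.

Lemma beta_linear : linear (@beta K).
Proof.
move=> a w1 w2; rewrite /beta scaler_sumr -big_split; apply: eq_bigr => i _ /=.
rewrite scaler_sumr -big_split; apply: eq_bigr => j _ /=.
by rewrite !mxE scalerDl scalerA.
Qed.

Lemma wedgeN (x y : V) : wedge y x = - wedge x y.
Proof. by rewrite /wedge opprB. Qed.

Lemma wedge_linearl (y : V) : linear (fun x : V => wedge x y).
Proof.
move=> a u v; rewrite /wedge mulmxDl linearD linearZ /= mulmxDr.
by rewrite -scalemxAl -scalemxAr scalerBr opprD addrACA.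
Qed.

Lemma V6_op_trilinear : trilinear op.
Proof.
split=> [y z | x z | x y] a u v; rewrite /V6_op.
- by rewrite wedge_linearl beta_linear V6_act_linearl.
- rewrite 3!(wedgeN _ x) wedge_linearl opprD -scalerN.
  by rewrite beta_linear V6_act_linearl.
- exact: V6_act_linear.
Qed.

Lemma V6_op_skew x y z : op x y z + op y x z = 0.
Proof.
rewrite /V6_op (wedgeN x y) (linear_opp beta_linear).
by rewrite (linear_opp (V6_act_linearl z)) subrr.
Qed.

Definition beta_coef (i j : nat) : int :=
  match i, j with
  | 0%N, 5%N => 2 | 0%N, 6%N => 1
  | 1%N, 4%N => -10 | 1%N, 5%N => -4 | 1%N, 6%N => 2
  | 2%N, 3%N => 20 | 2%N, 4%N => 5 | 2%N, 5%N => -10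
  | 3%N, 4%N => 20
  | _, _ => 0
  end.

(** beta respects weights: v_(6-2i) /\ v_(6-2j) has weight 12 - 2 (i + j), which
    is the weight of u2, u0, um2 for i + j = 5, 6, 7 and no weight of sl2
    otherwise. *)
Definition sl2_of_sum (s : nat) : 'M[K]_2 :=
  match s with 5%N => u2 K | 6%N => u0 K | 7%N => um2 K | _ => 0 end.

Definition H_coef (k : nat) : int := 6 - 2 * k%:Z.
Definition E_coef (k : nat) : int := if k is k'.+1 then 6 - k'%:Z else 0.
Definition F_coef (k : nat) : int := k%:Z + 1.

Definition op_coef (i j k : nat) : int :=
  (beta_coef i j - beta_coef j i) *
  match (i + j)%N with
  | 5%N => - E_coef k | 6%N => H_coef k | 7%N => F_coef k | _ => 0
  end.

Lemma V6H_wv k : V6H K *m wv k = (H_coef k)%:~R *: wv k.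
Proof.
case: (ltnP k 7) => [ltk|le7k]; last by rewrite wv_ge7 // mulmx0 scaler0.
rewrite -[k]/(nat_of_ord (Ordinal ltk)) wv_ord.
have := @V6H_v6 K (Ordinal ltk); rewrite /V6_act.
have [-> _ _] := V6_rep_basis K => ->.
by congr (_ *: _); rewrite /H_coef rmorphB rmorphM.
Qed.

Lemma V6E_wv k : V6E K *m wv k = (E_coef k)%:~R *: wv k.-1.
Proof.
case: (ltnP k 7) => [ltk|le7k]; last first.
  rewrite wv_ge7 // mulmx0; case: k le7k => // k; rewrite ltnS leq_eqVlt.
  by case/predU1P => [<-|lt6k]; rewrite ?scale0r //= wv_ge7 ?scaler0.
apply/matrixP => p l; rewrite (ord1 l) -[k in LHS]/(nat_of_ord (Ordinal ltk)).
rewrite wv_ord mul_v6 !mxE /=; case: k ltk => [|k] ltk.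
  by rewrite mul0r.
have e m : 7 - m.+1%:R = 6 - m%:R :> K by rewrite -addn1 natrD; ring.
by rewrite eqSS eq_sym rmorphB /= e; case: eqP => _; rewrite ?mulr1 ?mulr0.
Qed.

Lemma V6F_wv k : V6F K *m wv k = (F_coef k)%:~R *: wv k.+1.
Proof.
case: (ltnP k 7) => [ltk|le7k]; last first.
  by rewrite !wv_ge7 ?mulmx0 ?scaler0 // ltnW.
apply/matrixP => p l; rewrite (ord1 l) -[k]/(nat_of_ord (Ordinal ltk)) wv_ord.
rewrite mul_v6 !mxE /F_coef rmorphD /=.
by case: eqP => _; rewrite ?mulr1 ?mulr0.
Qed.

Lemma beta_wv i j : beta (wedge (wv i) (wv j)) =
  (beta_coef i j - beta_coef j i)%:~R *: sl2_of_sum (i + j).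
Proof.
have coef0 a b : (b <= a)%N || (6 < b)%N -> beta_coef a b = 0.
  by case: a => [|[|[|[|a]]]]; case: b => [|[|[|[|[|[|[|b]]]]]]].
have basisE a b : beta_basis K a b = (beta_coef a b)%:~R *: sl2_of_sum (a + b).
  case: a => [|[|[|[|a]]]]; case: b => [|[|[|[|[|[|[|b]]]]]]] /=;
  by rewrite ?scale0r ?scale1r ?rmorphN.
have ltE a b : (a < b)%N -> beta (wedge (wv a) (wv b)) =
    (beta_coef a b - beta_coef b a)%:~R *: sl2_of_sum (a + b).
  move=> ltab; rewrite (coef0 b a) ?(ltnW ltab) // subr0.
  case: (ltnP b 7) => [ltb|le7b]; last first.
    rewrite (coef0 a b) ?le7b ?orbT // scale0r (wv_ge7 le7b).
    by rewrite /wedge trmx0 mulmx0 mul0mx subrr (linear_zero beta_linear).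
  have lta := ltn_trans ltab ltb.
  rewrite -[a in LHS]/(nat_of_ord (Ordinal lta)).
  rewrite -[b in LHS]/(nat_of_ord (Ordinal ltb)) !wv_ord.
  by rewrite beta_v6 // basisE.
case: (ltngtP i j) => [/ltE //|/ltE ltji|->].
  rewrite wedgeN (linear_opp beta_linear) ltji addnC -scaleNr -rmorphN opprB //.
by rewrite /wedge !subrr scale0r (linear_zero beta_linear).
Qed.

Lemma V6_op_wv i j k :
  op (wv i) (wv j) (wv k) = (op_coef i j k)%:~R *: wv (i + j + k - 6).
Proof.
rewrite /V6_op beta_wv /op_coef rmorphM -scalerA /=.
have [HE EE FE] := V6_rep_basis K.
rewrite (linear_scale (V6_act_linearl _)); congr (_ *: _).
case: (i + j)%N => [|[|[|[|[|[|[|[|s]]]]]]]] /=;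
  rewrite ?scale0r ?(linear_zero (V6_act_linearl _)) //.
- rewrite /u2 (linear_opp (V6_act_linearl _)) /V6_act EE V6E_wv rmorphN scaleNr.
  by case: k => [|k]; rewrite ?scale0r //= addnS subSS addKn.
- by rewrite /V6_act HE V6H_wv addKn.
- by rewrite /V6_act FE V6F_wv addSnnS addKn.
Qed.

(** Multiples of weight vectors are closed under the product, so that
    the evaluation of monomials on them is a computation with pairs (c, i). *)
Definition scaled_wv (x : int * nat) : V := x.1%:~R *: wv x.2.
Local Notation mvec := scaled_wv.

Definition opz (x y z : int * nat) : int * nat :=
  (x.1 * y.1 * z.1 * op_coef x.2 y.2 z.2, (x.2 + y.2 + z.2 - 6)%N).

Lemma opzE x y z : op (mvec x) (mvec y) (mvec z) = mvec (opz x y z).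
Proof.
have [op1 op2 op3] := V6_op_trilinear.
rewrite /mvec (linear_scale (op1 _ _)) (linear_scale (op2 _ _)).
rewrite (linear_scale (op3 _ _)).
by rewrite V6_op_wv !scalerA !rmorphM /= !mulrA.
Qed.

Definition coord (l : nat) (x : int * nat) : int := if x.2 == l then x.1 else 0.

Lemma coordE (l : 'I_7) x : mvec x l 0 = (coord l x)%:~R.
Proof.
rewrite !mxE /coord eq_sym; case: eqP => _; first by rewrite mulr1.
by rewrite mulr0.
Qed.

Lemma wvE i : wv i = mvec (1, i).
Proof. by rewrite /mvec scale1r. Qed.

Lemma eq_on_weight_vectors n (M : seq V -> V) s : multilinear n M ->
  {in words (iota 0 7) n, forall p, M (map wv p) = 0} -> size s = n -> M s = 0.
Proof.
move=> mM M0 sn.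
have xE j : s`_j = \sum_(i <- iota 0 7) (s`_j : V) (inord i) 0 *: wv i.
  apply/matrixP => p q; rewrite (ord1 q) summxE.
  rewrite (bigD1_seq (nat_of_ord p)) ?mem_iota ?iota_uniq ?ltn_ord //.
  rewrite /= !mxE eqxx mulr1 inord_val big1 ?addr0 // => i.
  by rewrite eq_sym => /negPf ip; rewrite !mxE ip mulr0.
rewrite -(mkseq_nth 0 s) sn -[LHS]/(M ([::] ++ map _ _)).
rewrite (multilinear_expand mM _ xE) ?size_iota // big_seq big1 // => p pW.
by rewrite M0 ?scaler0.
Qed.

(** The action on pairs of a matrix whose value on wv k is the pair t k. *)
Definition matz (t : nat -> int * nat) (x : int * nat) : int * nat :=
  (x.1 * (t x.2).1, (t x.2).2).

(** The Leibniz rule for the matrix described by t, in the coordinate l of its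
    values on three weight vectors with indices p; the four terms may be
    represented by pairs with different indices when some coefficient is 0,
    whence the comparison of coordinates. *)
Definition leibniz_on (t : nat -> int * nat) (p : seq nat) (l : nat) : bool :=
  let x := (1, nth 0%N p 0) in
  let y := (1, nth 0%N p 1) in
  let z := (1, nth 0%N p 2) in
  coord l (matz t (opz x y z)) ==
    coord l (opz (matz t x) y z) + coord l (opz x (matz t y) z)
    + coord l (opz x y (matz t z)).

Definition derivation (T : 'M[K]_7) : Prop := forall x y z,
  T *m op x y z = op (T *m x) y z + op x (T *m y) z + op x y (T *m z).

Lemma derivation_comb a (S T : 'M[K]_7) :
  derivation S -> derivation T -> derivation (a *: S + T).
Proof.
have [op1 op2 op3] := V6_op_trilinear.
move=> dS dT x y z; rewrite !mulmxDl -!scalemxAl !(op1, op2, op3) dS dT.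
by rewrite !scalerDr [X in _ = X + _]addrACA [RHS]addrACA.
Qed.

Lemma derivation_of_table (T : 'M[K]_7) (t : nat -> int * nat) :
  (forall k, T *m wv k = mvec (t k)) ->
  all (fun p => all (leibniz_on t p) (iota 0 7)) (words (iota 0 7) 3) ->
  derivation T.
Proof.
move=> tE tab x y z.
have matE u : T *m mvec u = mvec (matz t u).
  by rewrite /mvec -scalemxAr tE /mvec scalerA -rmorphM.
apply/eqP; rewrite -subr_eq0; apply/eqP.
pose defect := leibniz_defect op (mulmx T).
apply: (@eq_on_weight_vectors 3 defect [:: x; y; z]) => //.
  apply: (leibniz_defect_multilinear V6_op_trilinear) => a u v.
  by rewrite mulmxDr scalemxAr.
move=> p pW; have sp := size_words pW.
have tp : all (leibniz_on t p) (iota 0 7) := allP tab p pW.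
apply/matrixP => i l; rewrite (ord1 l) /defect /leibniz_defect /mul3.
rewrite !(nth_map 0%N) ?sp //= !wvE !(matE, opzE) [LHS]mxE [X in _ + X]mxE.
rewrite [X in - X]mxE [X in - (X + _)]mxE !coordE.
have /eqP -> := allP tp (i : nat) (etrans (mem_iota 0 7 _) (ltn_ord i)).
by rewrite !rmorphD /= subrr mxE.
Qed.

(** The value of op a b is an element of sl2 acting on V(6), hence a combination
    of H, E and F, each of which is a derivation of the triple product since
    beta is a morphism of sl2-modules. *)
Lemma V6_op_derivation a b c d e :
  op a b (op c d e) = op (op a b c) d e + op c (op a b d) e + op c d (op a b e).
Proof.
have dH : derivation (V6H K).
  apply: (@derivation_of_table _ (fun k => (H_coef k, k)) V6H_wv).
  by vm_compute.
have dE : derivation (V6E K).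
  apply: (@derivation_of_table _ (fun k => (E_coef k, k.-1)) V6E_wv).
  by vm_compute.
have dF : derivation (V6F K).
  apply: (@derivation_of_table _ (fun k => (F_coef k, k.+1)) V6F_wv).
  by vm_compute.
have d0 : derivation 0.
  have [op1 op2 op3] := V6_op_trilinear; move=> x y z; rewrite !mul0mx.
  rewrite (linear_zero (op1 _ _)) (linear_zero (op2 _ _)).
  by rewrite (linear_zero (op3 _ _)) !addr0.
rewrite /V6_op /V6_act; set X := beta (wedge a b).
have : derivation (V6_rep X).
  rewrite /V6_rep -addrA -[X 1 0 *: _]addr0.
  by do !apply: derivation_comb.
exact.
Qed.

Definition mul1z (l : nat) (a : seq nat) : int := coord l (1, nth 0%N a 0).

Definition mul3z (l : nat) (a : seq nat) : int :=
  let x i := (1, nth 0%N a i) in coord l (opz (x 0%N) (x 1%N) (x 2%N)).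

Definition sym5lz (l : nat) (a : seq nat) : int :=
  let x i := (1, nth 0%N a i) in
  coord l (opz (opz (x 0%N) (x 1%N) (x 2%N)) (x 3%N) (x 4%N)) +
  coord l (opz (opz (x 0%N) (x 1%N) (x 3%N)) (x 2%N) (x 4%N)).

Definition mul5rz (l : nat) (a : seq nat) : int :=
  let x i := (1, nth 0%N a i) in
  coord l (opz (x 0%N) (x 1%N) (opz (x 2%N) (x 3%N) (x 4%N))).

Lemma mul1zE (l : 'I_7) a : size a = 1 ->
  mul1 (map wv a) l 0 = (mul1z l a)%:~R.
Proof. by move=> sa; rewrite /mul1 !(nth_map 0%N) ?sa // wvE coordE. Qed.

Lemma mul3zE (l : 'I_7) a : size a = 3 ->
  mul3 op (map wv a) l 0 = (mul3z l a)%:~R.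
Proof. by move=> sa; rewrite /mul3 !(nth_map 0%N) ?sa // !wvE !opzE coordE. Qed.

Lemma sym5lzE (l : 'I_7) a : size a = 5 ->
  sym5l op (map wv a) l 0 = (sym5lz l a)%:~R.
Proof.
move=> sa; rewrite /sym5l /mul5l !(nth_map 0%N) ?sa // !wvE !opzE mxE !coordE.
by rewrite rmorphD.
Qed.

Lemma mul5rzE (l : 'I_7) a : size a = 5 ->
  mul5r op (map wv a) l 0 = (mul5rz l a)%:~R.
Proof.
by move=> sa; rewrite /mul5r !(nth_map 0%N) ?sa // !wvE !opzE coordE.
Qed.

End WeightVectors.

(** * Transfer of identities from V(6) *)

Section Transfer.
Variable K : numFieldType.

Lemma multilinear_scale (V : lmodType K) n (M : seq V -> V) (t : K) s :
  multilinear n M -> size s = n ->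
  M [seq t *: x | x <- s] = t ^+ n *: M s.
Proof.
move=> mM sn; suff: forall s1 s2, (size s1 + size s2)%N = n ->
    M (s1 ++ [seq t *: x | x <- s2]) = t ^+ size s2 *: M (s1 ++ s2).
  by move=> /(_ [::] s sn); rewrite sn.
move=> s1 s2; elim: s2 s1 {s sn} => [|x s2 IHs2] s1 /= sn.
  by rewrite scale1r.
have sn' : (size s1 + size [seq t *: x | x <- s2]).+1 = n.
  by rewrite size_map -sn addnS.
rewrite (linear_scale (mM _ _ sn')) -cat_rcons IHs2 ?size_rcons ?addSnnS //.
by rewrite scalerA -exprS cat_rcons.
Qed.

Lemma sum_support (L : seq (seq nat)) (F : seq nat -> int) (g : seq nat -> K) :
  \sum_(p <- L) g p * (F p)%:~R =
  \sum_(q <- [seq (F p, p) | p <- L & F p != 0]) g q.2 * q.1%:~R.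
Proof.
rewrite big_map big_filter [RHS]big_mkcond; apply: eq_bigr => p _ /=.
by case: eqP => //= ->; rewrite mulr0.
Qed.

Definition perm_words n : seq (seq nat) :=
  [seq p <- words (iota 0 n) n | all (mem p) (iota 0 n)].

(** P is a formal combination of tuples of weight vectors. Evaluating, with
    entries permuted by p, a function whose values are tabulated by Mz gives
    this integer. *)
Definition test_value (P : seq (int * seq nat)) (Mz : seq nat -> int)
    (p : seq nat) : int :=
  foldr +%R 0 [seq ca.1 * Mz (rearrange ca.2 p) | ca <- P].

(** Polarizing and evaluating at the tuples of P turns the identity
    into a linear relation between the coefficients of all rearrangements of
    a word u. If P was chosen so that N is always killed and M survives only
    under the permutations in G, with the same value d up to the signs of G, the
    relation is the signed sum over G. *)
Lemma coef_relation n r (al be : seq nat -> K) (M N : seq (V6 K) -> V6 K)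
    (Mz Nz : seq nat -> int) (l : 'I_7) P (d : int) (G : seq (bool * seq nat)) :
  uniq r -> multilinear n M -> multilinear n N ->
  (forall a, size a = n -> M (map (wv K) a) l 0 = (Mz a)%:~R) ->
  (forall a, size a = n -> N (map (wv K) a) l 0 = (Nz a)%:~R) ->
  (forall x : nat -> V6 K,
     \sum_(w <- words r n) (al w *: M (map x w) + be w *: N (map x w)) = 0) ->
  d != 0 ->
  [seq (test_value P Mz p, p) | p <- perm_words n & test_value P Mz p != 0] =
    [seq ((-1) ^+ bg.1 * d, bg.2) | bg : bool * seq nat <- G] ->
  all (fun p => test_value P Nz p == 0) (perm_words n) ->
  {in words r n, forall u,
     \sum_(bg <- G) (-1) ^+ bg.1 * al (rearrange u bg.2) = 0}.
Proof.
move=> ur mM mN tM tN id0 d0 suppM suppN u uW.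
have rel a : \sum_(p <- perm_words n)
    (al (rearrange u p) * (Mz (rearrange a p))%:~R
     + be (rearrange u p) * (Nz (rearrange a p))%:~R) = 0.
  have := polarization (fun i => wv K (nth 0%N a i)) ur
    (fun w => multilinear_comb (al w) (be w) mM mN) id0 uW.
  move=> /(congr1 (fun v : V6 K => v l 0)); rewrite summxE mxE => e0.
  apply: etrans e0; rewrite -[RHS]big_filter; apply: eq_big_seq => p.
  rewrite mem_filter => /andP[_ pW].
  have sp : size (rearrange a p) = n by rewrite size_map (size_words pW).
  by rewrite map_comp -/(rearrange a p) !mxE tM ?tN.
have : \sum_(p <- perm_words n)
    al (rearrange u p) * (test_value P Mz p)%:~R = 0.
  have combE (Qz : seq nat -> int) p : (test_value P Qz p)%:~R =
      \sum_(ca <- P) ca.1%:~R * (Qz (rearrange ca.2 p))%:~R :> K.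
    rewrite /test_value foldrE big_map rmorph_sum; apply: eq_bigr => ca _.
    by rewrite rmorphM.
  transitivity (\sum_(ca <- P) ca.1%:~R * \sum_(p <- perm_words n)
    (al (rearrange u p) * (Mz (rearrange ca.2 p))%:~R
     + be (rearrange u p) * (Nz (rearrange ca.2 p))%:~R)); last first.
    by rewrite big1 // => ca _; rewrite rel mulr0.
  under [RHS]eq_bigr do rewrite mulr_sumr.
  rewrite exchange_big; apply: eq_big_seq => p pW /=.
  under [RHS]eq_bigr do
    rewrite mulrDr 2!mulrA 2![_%:~R * _ (rearrange _ _)]mulrC -2!mulrA.
  rewrite big_split -!mulr_sumr -!combE (eqP (allP suppN p pW)).
  by rewrite rmorph0 mulr0 [RHS]addr0.
rewrite sum_support suppM big_map /=.
under eq_bigr do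
  rewrite rmorphM rmorphXn rmorphN rmorph1 /= mulrA (mulrC (al _)).
rewrite -mulr_suml => /eqP; rewrite mulf_eq0 intr_eq0 (negPf d0) orbF.
by move/eqP.
Qed.

(** Since M changes by the signs of G under its permutations, the sum does not
    change if al is replaced by its signed average over G. *)
Lemma signed_sum_eq0 (V : lmodType K) n r (al : seq nat -> K) (M : seq V -> V)
    (G : seq (bool * seq nat)) (s : nat -> V) :
  uniq r -> G != [::] ->
  {in G, forall bg : bool * seq nat, perm_eq bg.2 (iota 0 n) /\
     forall y : seq V, size y = n ->
     M [seq y`_i | i <- bg.2] = (-1) ^+ bg.1 *: M y} ->
  {in words r n, forall u,
     \sum_(bg <- G) (-1) ^+ bg.1 * al (rearrange u bg.2) = 0} ->
  \sum_(w <- words r n) al w *: M (map s w) = 0.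
Proof.
move=> ur G0 symM al0.
suff /eqP: (size G)%:R *: \sum_(w <- words r n) al w *: M (map s w) = 0.
  by rewrite scaler_eq0 pnatr_eq0 size_eq0 (negPf G0) => /eqP.
transitivity (\sum_(bg <- G) \sum_(w <- words r n) al w *: M (map s w)).
  by rewrite big_const_seq count_predT iter_addr_0 scaler_nat.
transitivity (\sum_(bg <- G) \sum_(w <- words r n)
    ((-1) ^+ bg.1 * al (rearrange w bg.2)) *: M (map s w)).
  apply: eq_big_seq => bg /symM[pg Mg]; rewrite (big_rearrange _ ur pg).
  apply: eq_big_seq => w wW; have sw := size_words wW.
  have gW : bg.2 \in words (iota 0 n) n.
    rewrite mem_words (perm_size pg) size_iota eqxx /=.
    by apply/allP => i; rewrite (perm_mem pg).
  by rewrite (map_rearrange _ 0 sw gW) Mg ?size_map // scalerA mulrC.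
rewrite exchange_big big_seq big1 // => w wW /=.
by rewrite -scaler_suml al0 ?scale0r.
Qed.

End Transfer.

(** * Polynomials of degree at most five *)

Definition mon1 (w : seq nat) : tmon := Var (nth 0%N w 0).
Definition mon3 (w : seq nat) : tmon :=
  let x i := Var (nth 0%N w i) in Op (x 0) (x 1) (x 2).
Definition mon5l (w : seq nat) : tmon :=
  let x i := Var (nth 0%N w i) in Op (Op (x 0) (x 1) (x 2)) (x 3) (x 4).
Definition mon5m (w : seq nat) : tmon :=
  let x i := Var (nth 0%N w i) in Op (x 0) (Op (x 1) (x 2) (x 3)) (x 4).
Definition mon5r (w : seq nat) : tmon :=
  let x i := Var (nth 0%N w i) in Op (x 0) (x 1) (Op (x 2) (x 3) (x 4)).

Fixpoint leaves (m : tmon) : seq nat :=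
  match m with
  | Var i => [:: i]
  | Op m1 m2 m3 => leaves m1 ++ leaves m2 ++ leaves m3
  end.

(** Two factors of degree at least 3 would make the degree at least 7. *)
Lemma tmon_deg_le5 m : (tmon_deg m <= 5)%N ->
  [\/ size (leaves m) = 1%N /\ m = mon1 (leaves m),
      size (leaves m) = 3%N /\ m = mon3 (leaves m) |
      size (leaves m) = 5%N /\ [\/ m = mon5l (leaves m), m = mon5m (leaves m)
                                 | m = mon5r (leaves m)]].
Proof.
have gt0 x : (0 < tmon_deg x)%N.
  by elim: x => //= x1 IH1 x2 IH2 x3 IH3; rewrite !addn_gt0 IH1.
have varP x : (exists i, x = Var i) \/ (3 <= tmon_deg x)%N.
  case: x => [i|a b c]; [by left; exists i | right => /=].
  have := gt0 a; have := gt0 b; have := gt0 c; lia.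
have degP x : (tmon_deg x <= 3)%N -> (exists i, x = Var i) \/
    exists i j k, x = Op (Var i) (Var j) (Var k).
  case: x => [i|a b c] /=; first by left; exists i.
  have := gt0 a; have := gt0 b; have := gt0 c.
  case: (varP a) => [[i ->]|]; last lia.
  case: (varP b) => [[j ->]|]; last lia.
  case: (varP c) => [[k ->]|]; last lia.
  by right; exists i, j, k.
case: m => [i|a b c] /=; first by constructor 1.
have := gt0 a; have := gt0 b; have := gt0 c => c0 b0 a0 le5.
have /degP Da : (tmon_deg a <= 3)%N by lia.
have /degP Db : (tmon_deg b <= 3)%N by lia.
have /degP Dc : (tmon_deg c <= 3)%N by lia.
move: le5; case: Da => [[i ->]|[i [i' [i'' ->]]]];
  case: Db => [[j ->]|[j [j' [j'' ->]]]];
  case: Dc => [[k ->]|[k [k' [k'' ->]]]] => //= _.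
- by constructor 2.
- by constructor 3; split=> //; constructor 3.
- by constructor 3; split=> //; constructor 2.
- by constructor 3; split=> //; constructor 1.
Qed.

Section Evaluation.
Variables (K : fieldType) (V : lmodType K).
Variables (op : V -> V -> V -> V) (s : nat -> V).

Lemma tpoly_evalE (f : tpoly K) (L : seq tmon) : uniq L ->
  (forall m, m \notin L -> f@_m = 0) ->
  tpoly_eval op s f = \sum_(m <- L) f@_m *: tmon_eval op s m.
Proof.
move=> uL f0; rewrite /tpoly_eval [RHS](bigID (mem (msupp f))) /=.
rewrite [X in _ = _ + X]big1 ?addr0 => [|m /mcoeff_outdom ->]; last first.
  by rewrite scale0r.
rewrite -[RHS]big_filter; apply: perm_big; apply: uniq_perm.
- exact: fset_uniq.
- exact: filter_uniq.
move=> m; rewrite mem_filter; case: (boolP (m \in msupp f)) => //= mf.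
apply/esym/negPn/negP => /f0 /eqP; rewrite mcoeff_eq0 mf //.
Qed.

Lemma tpoly_evalB (f g : tpoly K) :
  tpoly_eval op s (f - g) = tpoly_eval op s f - tpoly_eval op s g.
Proof.
pose L : seq tmon := undup (msupp f ++ msupp g).
have L0 m : m \notin L -> f@_m = 0 /\ g@_m = 0.
  rewrite mem_undup mem_cat negb_or => /andP[mf mg].
  by rewrite !mcoeff_outdom.
have uL : uniq L := undup_uniq _.
rewrite !(tpoly_evalE uL) => [|m /L0[]|m /L0[]|m /L0[]] //.
  by rewrite -sumrB; apply: eq_bigr => m _; rewrite mcoeffB scalerBl.
by move=> f0 g0; rewrite mcoeffB f0 g0 subr0.
Qed.

Lemma tpoly_eval0 : tpoly_eval op s (0 : tpoly K) = 0.
Proof. by rewrite -(subrr 0) tpoly_evalB subrr. Qed.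

Lemma tpoly_evalD (f g : tpoly K) :
  tpoly_eval op s (f + g) = tpoly_eval op s f + tpoly_eval op s g.
Proof.
by rewrite -[g in LHS]opprK -[- g]sub0r !tpoly_evalB tpoly_eval0 sub0r opprK.
Qed.

Lemma tpoly_evalU (m : tmon) : tpoly_eval op s << m >> = tmon_eval op s m.
Proof.
rewrite (@tpoly_evalE _ [:: m]) // => [|m' m'm].
  by rewrite big_seq1 mcoeffUU scale1r.
by rewrite mcoeffU eq_sym; move: m'm; rewrite inE => /negPf ->.
Qed.

Lemma tmon_eval1 w : size w = 1%N ->
  tmon_eval op s (mon1 w) = mul1 (map s w).
Proof. by move=> sw; rewrite /mul1 !(nth_map 0%N) ?sw. Qed.

Lemma tmon_eval3 w : size w = 3%N ->
  tmon_eval op s (mon3 w) = mul3 op (map s w).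
Proof. by move=> sw; rewrite /mul3 !(nth_map 0%N) ?sw. Qed.

Lemma tmon_eval5 w : size w = 5%N ->
  [/\ tmon_eval op s (mon5l w) = mul5l op (map s w),
      tmon_eval op s (mon5m w) = mul5m op (map s w) &
      tmon_eval op s (mon5r w) = mul5r op (map s w)].
Proof. by move=> sw; rewrite /mul5l /mul5m /mul5r !(nth_map 0%N) ?sw. Qed.

Definition part1 (f : tpoly K) (r : seq nat) : V :=
  \sum_(w <- words r 1) f@_(mon1 w) *: mul1 (map s w).
Definition part3 (f : tpoly K) (r : seq nat) : V :=
  \sum_(w <- words r 3) f@_(mon3 w) *: mul3 op (map s w).
Definition part5 (f : tpoly K) (r : seq nat) : V :=
  \sum_(w <- words r 5) (f@_(mon5l w) *: mul5l op (map s w) +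
    f@_(mon5m w) *: mul5m op (map s w) + f@_(mon5r w) *: mul5r op (map s w)).

Lemma tpoly_eval_parts (f : tpoly K) (r : seq nat) : uniq r -> deg_le 5 f ->
  (forall m, m \in msupp f -> {subset leaves m <= r}) ->
  tpoly_eval op s f = part1 f r + part3 f r + part5 f r.
Proof.
move=> ur degf fr; have uW n := words_uniq n ur.
pose mon k := nth mon1 [:: mon1; mon3; mon5l; mon5m; mon5r] k.
pose ar k := nth 0%N [:: 1; 3; 5; 5; 5]%N k.
pose L := [seq mon k w | k <- iota 0 5, w <- words r (ar k)].
pose shape m := match m with
  | Var _ => 0 | Op (Op _ _ _) _ _ => 2 | Op _ (Op _ _ _) _ => 3
  | Op _ _ (Op _ _ _) => 4 | _ => 1 end%N.
have LP k w : k \in iota 0 5 -> w \in words r (ar k) ->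
    shape (mon k w) = k /\ leaves (mon k w) = w.
  rewrite mem_iota => /andP[_]; move: k => [|[|[|[|[|k]]]]] // _ /size_words;
  by case: w => [|? [|? [|? [|? [|? []]]]]].
have uL : uniq L.
  apply: allpairs_uniq_dep; rewrite ?iota_uniq // => -[k1 w1] [k2 w2].
  case/allpairsPdep=> k1' [w1' [k1s w1s [-> ->]]].
  case/allpairsPdep=> k2' [w2' [k2s w2s [-> ->]]] /= e.
  have [sh1 lf1] := LP _ _ k1s w1s; have [sh2 lf2] := LP _ _ k2s w2s.
  have -> : k1' = k2' by rewrite -sh1 e.
  by have -> : w1' = w2' by rewrite -lf1 e.
have LM k w : k \in iota 0 5 -> w \in words r (ar k) -> mon k w \in L.
  by move=> ks ws; apply/allpairsPdep; exists k, w.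
have cover m : m \notin L -> f@_m = 0.
  apply: contraNeq => mf; rewrite mcoeff_neq0 in mf.
  have lW n : size (leaves m) = n -> leaves m \in words r n.
    by move=> sl; rewrite mem_words sl eqxx; apply/allP; apply: fr.
  have [[/lW + e]|[/lW + e]|[/lW mW]] := tmon_deg_le5 (degf m mf).
  - by move=> mW; rewrite e; apply: (LM 0%N).
  - by move=> mW; rewrite e; apply: (LM 1%N).
  case=> e; rewrite e.
  - by apply: (LM 2%N).
  - by apply: (LM 3%N).
  - by apply: (LM 4%N).
have bigE (F : nat -> V) : \sum_(k <- iota 0 5) F k =
    F 0%N + (F 1%N + (F 2%N + (F 3%N + F 4%N))).
  by rewrite !big_cons big_nil addr0.
rewrite (tpoly_evalE uL cover) /L big_allpairs_dep bigE.
have split5 (F G H : seq nat -> V) :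
    \sum_(w <- words r 5) (F w + G w + H w) = \sum_(w <- words r 5) F w +
      \sum_(w <- words r 5) G w + \sum_(w <- words r 5) H w.
  by rewrite !big_split.
rewrite /part1 /part3 /part5 split5 -!addrA; congr (_ + (_ + (_ + (_ + _))));
  apply: eq_big_seq => w /size_words sw /=.
- by rewrite -tmon_eval1.
- by rewrite -tmon_eval3.
- by have [<- _ _] := tmon_eval5 sw.
- by have [_ <- _] := tmon_eval5 sw.
- by have [_ _ <-] := tmon_eval5 sw.
Qed.

End Evaluation.

(** * Reduction modulo skew-symmetry and the derivation identity *)

(** The symmetries of mul3, sym5l and mul5r forced by skew-symmetry, true
    meaning a change of sign. They are in the lexicographic order in which words
    lists the permutations. *)
Definition mul3_signs : seq (bool * seq nat) :=
  [:: (false, [:: 0; 1; 2]); (true, [:: 1; 0; 2])]%N.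
Definition sym5l_signs : seq (bool * seq nat) :=
  [:: (false, [:: 0; 1; 2; 3; 4]); (false, [:: 0; 1; 3; 2; 4]);
      (true, [:: 1; 0; 2; 3; 4]); (true, [:: 1; 0; 3; 2; 4])]%N.
Definition mul5r_signs : seq (bool * seq nat) :=
  [:: (false, [:: 0; 1; 2; 3; 4]); (true, [:: 0; 1; 3; 2; 4]);
      (true, [:: 1; 0; 2; 3; 4]); (false, [:: 1; 0; 3; 2; 4])]%N.

Section Reduction.
Variables (K : numFieldType) (V : lmodType K) (op : V -> V -> V -> V).

Definition skew : Prop := forall a b c, op a b c + op b a c = 0.
Definition pair_derivation : Prop := forall a b c d e,
  op (op a b c) d e - op (op a b d) c e - op a b (op c d e)
    + op c d (op a b e) = 0.

Hypotheses (op_tri : trilinear op) (op_skew : skew) (op_der : pair_derivation).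

Lemma opN a b c : op b a c = - op a b c.
Proof. by apply/eqP; rewrite -addr_eq0 op_skew. Qed.

Lemma op_opl a b c : op (- a) b c = - op a b c.
Proof. by have [op1 _ _] := op_tri; rewrite (linear_opp (op1 _ _)). Qed.

Lemma op_opr a b c : op a b (- c) = - op a b c.
Proof. by have [_ _ op3] := op_tri; rewrite (linear_opp (op3 _ _)). Qed.

(** A middle monomial (x, (y, z, u), v) is the opposite of ((y, z, u), x, v),
    which reads positions in the order 1, 2, 3, 0, 4; the list here is the inverse
    permutation. *)
Definition left_coef (cl cm : seq nat -> K) (w : seq nat) : K :=
  cl w - cm (rearrange w [:: 3; 0; 1; 2; 4]%N).

Definition right_coef (cl cm cr : seq nat -> K) (w : seq nat) : K :=
  2 * cr w + left_coef cl cm w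
    - left_coef cl cm (rearrange w [:: 2; 3; 0; 1; 4]%N).

(** The derivation identity says that the difference between a left monomial
    and the one with its third and fourth letters exchanged is the difference
    between the right monomial and the one with the pairs of its first four
    letters exchanged; hence twice the left monomial is sym5l plus the
    difference of these right monomials. *)
Lemma normal_form5 (cl cm cr : seq nat -> K) (r : seq nat) (s : nat -> V) :
  uniq r ->
  2 *: \sum_(w <- words r 5) (cl w *: mul5l op (map s w)
         + cm w *: mul5m op (map s w) + cr w *: mul5r op (map s w)) =
  \sum_(w <- words r 5) (left_coef cl cm w *: sym5l op (map s w)
         + right_coef cl cm cr w *: mul5r op (map s w)).
Proof.
move=> ur.
have words5 w : w \in words r 5 -> exists a b c d e, w = [:: a; b; c; d; e].
  move=> /size_words; case: w => [|a [|b [|c [|d [|e []]]]]] // _.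
  by exists a, b, c, d, e.
have mid : \sum_(w <- words r 5) cm w *: mul5m op (map s w) =
    \sum_(w <- words r 5)
      - (cm (rearrange w [:: 3; 0; 1; 2; 4]%N) *: mul5l op (map s w)).
  rewrite (big_rearrange _ ur (isT : perm_eq [:: 3; 0; 1; 2; 4]%N (iota 0 5))).
  apply: eq_big_seq => w /words5 [a [b [c [d [e ->]]]]].
  by rewrite /mul5m /mul5l /= opN scalerN.
have swap : \sum_(w <- words r 5) left_coef cl cm w *:
      mul5r op (map s (rearrange w [:: 2; 3; 0; 1; 4]%N)) =
    \sum_(w <- words r 5) left_coef cl cm (rearrange w [:: 2; 3; 0; 1; 4]%N) *:
      mul5r op (map s w).
  rewrite (big_rearrange _ ur (isT : perm_eq [:: 2; 3; 0; 1; 4]%N (iota 0 5))).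
  by apply: eq_big_seq => w /words5 [a [b [c [d [e ->]]]]].
have double w : w \in words r 5 -> 2 *: mul5l op (map s w) =
    sym5l op (map s w) + mul5r op (map s w)
    - mul5r op (map s (rearrange w [:: 2; 3; 0; 1; 4]%N)).
  case/words5=> [a [b [c [d [e ->]]]]]; rewrite /sym5l /mul5l /mul5r /=.
  have := op_der (s a) (s b) (s c) (s d) (s e).
  set X := op _ _ _; set Y := op _ _ _; set P := op _ _ _; set Q := op _ _ _.
  move=> XYPQ; apply/eqP; rewrite -subr_eq0 -[X in _ == X]XYPQ; apply/eqP.
  by rewrite scaler_nat mulr2n !opprD opprK !addrA addrK.
transitivity (2 *: \sum_(w <- words r 5)
    (left_coef cl cm w *: mul5l op (map s w) + cr w *: mul5r op (map s w))).
  congr (_ *: _); rewrite !big_split /= mid -!big_split.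
  by apply: eq_bigr => w _ /=; rewrite scalerBl.
transitivity (\sum_(w <- words r 5) (left_coef cl cm w *: sym5l op (map s w)
    + (2 * cr w + left_coef cl cm w) *: mul5r op (map s w)
    - left_coef cl cm w *:
        mul5r op (map s (rearrange w [:: 2; 3; 0; 1; 4]%N)))).
  rewrite scaler_sumr; apply: eq_big_seq => w wW.
  rewrite scalerDr scalerA mulrC -scalerA double // scalerBr scalerDr scalerDl.
  by rewrite scalerA addrAC; congr (_ - _); rewrite addrAC -addrA.
rewrite sumrB swap -sumrB; apply: eq_bigr => w _.
by rewrite -addrA -scalerBl.
Qed.

Lemma mul3_symmetry : {in mul3_signs, forall bg : bool * seq nat,
  perm_eq bg.2 (iota 0 3) /\ forall y : seq V, size y = 3%N ->
    mul3 op [seq y`_i | i <- bg.2] = (-1) ^+ bg.1 *: mul3 op y}.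
Proof.
move=> bg; rewrite !inE => /orP[] /eqP ->; split=> //=.
  by case=> [|a [|b [|c []]]] //= _; rewrite scale1r.
by case=> [|a [|b [|c []]]] //= _; rewrite /mul3 /= scaleN1r opN.
Qed.

Lemma sym5l_symmetry : {in sym5l_signs, forall bg : bool * seq nat,
  perm_eq bg.2 (iota 0 5) /\ forall y : seq V, size y = 5%N ->
    sym5l op [seq y`_i | i <- bg.2] = (-1) ^+ bg.1 *: sym5l op y}.
Proof.
move=> bg; rewrite !inE => /or4P[] /eqP ->; split=> //=;
  case=> [|a [|b [|c [|d [|e []]]]]] //= _; rewrite /sym5l /mul5l /=.
- by rewrite scale1r.
- by rewrite scale1r addrC.
- by rewrite scaleN1r !(opN a b) !op_opl opprD.
- by rewrite scaleN1r !(opN a b) !op_opl opprD addrC.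
Qed.

Lemma mul5r_symmetry : {in mul5r_signs, forall bg : bool * seq nat,
  perm_eq bg.2 (iota 0 5) /\ forall y : seq V, size y = 5%N ->
    mul5r op [seq y`_i | i <- bg.2] = (-1) ^+ bg.1 *: mul5r op y}.
Proof.
move=> bg; rewrite !inE => /or4P[] /eqP ->; split=> //=;
  case=> [|a [|b [|c [|d [|e []]]]]] //= _; rewrite /mul5r /=.
- by rewrite scale1r.
- by rewrite scaleN1r (opN c d) op_opr.
- by rewrite scaleN1r (opN a b).
- by rewrite scale1r (opN a b) (opN c d) op_opr opprK.
Qed.

End Reduction.

(** * Identities of V(6) *)

Section Identities.
Variable K : numFieldType.
Local Notation V6 := (V6 K).
Local Notation op6 := (@V6_op K).

Lemma V6_op_pair_derivation : pair_derivation op6.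
Proof.
move=> a b c d e.
rewrite (V6_op_derivation a b) (opN (@V6_op_skew K) (op6 a b d) c).
set X := op6 _ d e; set Y := op6 _ c e; set Z := op6 c d _.
by rewrite opprD addrA subrr add0r addNr.
Qed.

Lemma coef_relation1 n r (al : seq nat -> K) (M : seq V6 -> V6)
    (Mz : seq nat -> int) (l : 'I_7) P (d : int) (G : seq (bool * seq nat)) :
  uniq r -> multilinear n M ->
  (forall a, size a = n -> M (map (wv K) a) l 0 = (Mz a)%:~R) ->
  (forall x : nat -> V6, \sum_(w <- words r n) al w *: M (map x w) = 0) ->
  d != 0 ->
  [seq (test_value P Mz p, p) | p <- perm_words n & test_value P Mz p != 0] =
    [seq ((-1) ^+ bg.1 * d, bg.2) | bg : bool * seq nat <- G] ->
  {in words r n, forall u,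
     \sum_(bg <- G) (-1) ^+ bg.1 * al (rearrange u bg.2) = 0}.
Proof.
move=> ur mM tM id0 d0 suppM.
have mN : multilinear n (fun=> 0 : V6).
  by move=> s1 s2 _ a u v; rewrite scaler0 addr0.
apply: (coef_relation (be := fun=> 0) (N := fun=> 0) (Nz := fun=> 0) (P := P)
  ur mM mN tM _ _ d0 suppM).
- by move=> a _; rewrite mxE.
- move=> x; rewrite -[RHS](id0 x); apply: eq_bigr => w _.
  by rewrite scaler0 addr0.
apply/allP => p _; rewrite /test_value; elim: P {suppM} => //= ca P /eqP ->.
by rewrite mulr0.
Qed.

Variables (V : lmodType K) (op : V -> V -> V -> V).
Hypotheses (op_tri : trilinear op) (op_skew : skew op).
Hypothesis op_der : pair_derivation op.

Lemma transfer1 r (c : seq nat -> K) (s : nat -> V) : uniq r ->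
  (forall x : nat -> V6, \sum_(w <- words r 1) c w *: mul1 (map x w) = 0) ->
  \sum_(w <- words r 1) c w *: mul1 (map s w) = 0.
Proof.
move=> ur id0.
apply: (signed_sum_eq0 (G := [:: (false, [:: 0%N])])) => //.
  move=> bg; rewrite inE => /eqP ->; split=> // -[|a []] //= _.
  by rewrite scale1r.
by apply: (coef_relation1 (l := ord0) (P := [:: (1, [:: 0%N])]) (d := 1) ur
  (@mul1_multilinear _ _) (@mul1zE K ord0) id0); vm_compute.
Qed.

(** At (v_6, v_-6, v_2) only the wedge of v_6 and v_-6 has a nonzero image
    under beta, namely H, so that only two of the six arrangements survive. *)
Lemma transfer3 r (c : seq nat -> K) (s : nat -> V) : uniq r ->
  (forall x : nat -> V6, \sum_(w <- words r 3) c w *: mul3 op6 (map x w) = 0) ->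
  \sum_(w <- words r 3) c w *: mul3 op (map s w) = 0.
Proof.
move=> ur id0; apply: (signed_sum_eq0 s ur _ (mul3_symmetry op_skew)) => //.
pose l : 'I_7 := @Ordinal 7 2 isT.
by apply: (coef_relation1 (P := [:: (1, [:: 0; 6; 2]%N)]) (d := 2) ur
  (mul3_multilinear (@V6_op_trilinear K)) (@mul3zE K l) id0); vm_compute.
Qed.

Lemma transfer5 r (cl cm cr : seq nat -> K) (s : nat -> V) : uniq r ->
  (forall x : nat -> V6,
    \sum_(w <- words r 5) (cl w *: mul5l op6 (map x w)
      + cm w *: mul5m op6 (map x w) + cr w *: mul5r op6 (map x w)) = 0) ->
  \sum_(w <- words r 5) (cl w *: mul5l op (map s w)
      + cm w *: mul5m op (map s w) + cr w *: mul5r op (map s w)) = 0.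
Proof.
move=> ur id0.
pose al := left_coef cl cm; pose be := right_coef cl cm cr.
have tri6 := @V6_op_trilinear K; have skew6 : skew op6 := @V6_op_skew K.
have id1 x : \sum_(w <- words r 5)
    (al w *: sym5l op6 (map x w) + be w *: mul5r op6 (map x w)) = 0.
  by rewrite -(normal_form5 skew6 V6_op_pair_derivation) // id0 scaler0.
have relL : {in words r 5, forall u,
    \sum_(bg <- sym5l_signs) (-1) ^+ bg.1 * al (rearrange u bg.2) = 0}.
  (* On these vectors the values lie on the line of index 5, the sum of
     the indices being 17 and each of the two products subtracting 6. *)
  pose l : 'I_7 := @Ordinal 7 5 isT.
  by apply: (coef_relation (P := [:: (1, [:: 0; 5; 3; 3; 6]%N)]) (d := 320) ur
    (sym5l_multilinear tri6) (mul5r_multilinear tri6)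
    (@sym5lzE K l) (@mul5rzE K l) id1); vm_compute.
have id2 x : \sum_(w <- words r 5) be w *: mul5r op6 (map x w) = 0.
  have := id1 x; rewrite big_split /=.
  have symL := sym5l_symmetry tri6 skew6.
  by rewrite (signed_sum_eq0 _ ur _ symL relL) // add0r.
have relR : {in words r 5, forall u,
    \sum_(bg <- mul5r_signs) (-1) ^+ bg.1 * be (rearrange u bg.2) = 0}.
  (* At either tuple only two words survive up to symmetry, 01234 and 04231:
     the values of mul5r are -120 and 120 at the first tuple, -60 and -60 at the
     second one. The combination cancels the second word. *)
  pose l : 'I_7 := @Ordinal 7 3 isT.
  by apply: (coef_relation1
    (P := [:: (-1, [:: 3; 2; 0; 6; 4]%N); (-2, [:: 1; 4; 0; 6; 4]%N)])
    (d := 240) ur (mul5r_multilinear tri6) (@mul5rzE K l) id2); vm_compute.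
have := normal_form5 op_skew op_der cl cm cr s ur.
have symL := sym5l_symmetry op_tri op_skew.
have symR := mul5r_symmetry op_tri op_skew.
rewrite -/al -/be [RHS]big_split /= (signed_sum_eq0 _ ur _ symL relL) //.
rewrite (signed_sum_eq0 _ ur _ symR relR) // addr0.
by move/eqP; rewrite scaler_eq0 pnatr_eq0 => /eqP.
Qed.

End Identities.

(** The values t = 1, 2, 3 suffice, as the Vandermonde-like determinant of
    t, t^3, t^5 at these points is not zero. *)
Lemma homogeneous_parts_eq0 (K : numFieldType) (p q r : V6 K) :
  (forall t : K, t *: p + t ^+ 3 *: q + t ^+ 5 *: r = 0) ->
  [/\ p = 0, q = 0 & r = 0].
Proof.
move=> pqr.
have r0 : r = 0.
  apply/matrixP => i j.
  have e1 := congr1 (fun v : V6 K => v i j) (pqr 1).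
  have e2 := congr1 (fun v : V6 K => v i j) (pqr 2).
  have e3 := congr1 (fun v : V6 K => v i j) (pqr 3).
  rewrite !mxE in e1 e2 e3 *.
  have : 120 * r i j = 0 :> K.
    transitivity ((3 * p i j + 3 ^+ 3 * q i j + 3 ^+ 5 * r i j)
      - 4 * (2 * p i j + 2 ^+ 3 * q i j + 2 ^+ 5 * r i j)
      + 5 * (1 * p i j + 1 ^+ 3 * q i j + 1 ^+ 5 * r i j)); first by ring.
    by rewrite e1 e2 e3 !mulr0 subr0 addr0.
  by move/eqP; rewrite mulf_eq0 pnatr_eq0 => /eqP.
have q0 : q = 0.
  apply/matrixP => i j.
  have e1 := congr1 (fun v : V6 K => v i j) (pqr 1).
  have e2 := congr1 (fun v : V6 K => v i j) (pqr 2).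
  rewrite r0 !mxE in e1 e2 *.
  have : 6 * q i j = 0 :> K.
    transitivity ((2 * p i j + 2 ^+ 3 * q i j + 2 ^+ 5 * 0)
      - 2 * (1 * p i j + 1 ^+ 3 * q i j + 1 ^+ 5 * 0)); first by ring.
    by rewrite e1 e2 !mulr0 subr0.
  by move/eqP; rewrite mulf_eq0 pnatr_eq0 => /eqP.
by have := pqr 1; rewrite r0 q0 !scaler0 !addr0 scale1r.
Qed.

Lemma identities_deg_le5 (K : numFieldType) (f : tpoly K) :
  deg_le 5 f -> satisfies (@V6_op K) f ->
  consequence [:: skew_symmetry K; ternary_derivation K] f.
Proof.
move=> degf f6 V op op_tri opS s.
have op_skew : skew op.
  move=> a b c; have := opS _ (mem_head _ _) (nth 0 [:: a; b; c]).
  by rewrite tpoly_evalD !tpoly_evalU.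
have op_der : pair_derivation op.
  move=> a b c d e.
  have /opS/(_ (nth 0 [:: a; b; c; d; e])) : ternary_derivation K
    \in [:: skew_symmetry K; ternary_derivation K] by rewrite !inE eqxx orbT.
  by rewrite tpoly_evalD !tpoly_evalB !tpoly_evalU.
pose r := undup (flatten [seq leaves m | m <- msupp f]).
have ur : uniq r := undup_uniq _.
have fr m : m \in msupp f -> {subset leaves m <= r}.
  move=> mf i im; rewrite mem_undup; apply/flattenP.
  by exists (leaves m); rewrite ?map_f.
have parts (W : lmodType K) (o : W -> W -> W -> W) (x : nat -> W) :
    tpoly_eval o x f = part1 x f r + part3 o x f r + part5 o x f r.
  exact: tpoly_eval_parts.
have tri6 := @V6_op_trilinear K.
have parts6 (x : nat -> V6 K) :
  [/\ part1 x f r = 0, part3 (@V6_op K) x f r = 0 & part5 (@V6_op K) x f r = 0].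
  apply: homogeneous_parts_eq0 => t.
  have scaleE n (M : seq (V6 K) -> V6 K) w : multilinear n M ->
      w \in words r n -> M [seq t *: x i | i <- w] = t ^+ n *: M (map x w).
    move=> mM wW; have sw := size_words wW.
    by rewrite -(multilinear_scale t mM) ?size_map // -map_comp.
  have sum_scale n (F G : seq nat -> V6 K) :
      {in words r n, forall w, F w = t ^+ n *: G w} ->
      \sum_(w <- words r n) F w = t ^+ n *: \sum_(w <- words r n) G w.
    by move=> FG; rewrite scaler_sumr; apply: eq_big_seq.
  have := f6 (fun i => t *: x i); rewrite parts => e; rewrite -[t]expr1 -e.
  congr (_ + _ + _); apply/esym/sum_scale => w wW.
  - rewrite (scaleE 1%N) ?scalerA 1?mulrC -?scalerA //.
    exact: mul1_multilinear.
  - rewrite (scaleE 3%N) ?scalerA 1?mulrC -?scalerA //.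
    exact: mul3_multilinear.
  rewrite (scaleE _ _ _ (mul5l_multilinear tri6)) //.
  rewrite (scaleE _ _ _ (mul5m_multilinear tri6)) //.
  rewrite (scaleE _ _ _ (mul5r_multilinear tri6)) // !scalerDr !scalerA.
  by rewrite !(mulrC (t ^+ 5)).
have v1 : part1 s f r = 0.
  by apply: transfer1 => // x; have [] := parts6 x.
have v3 : part3 op s f r = 0.
  by apply: transfer3 => // x; have [] := parts6 x.
have v5 : part5 op s f r = 0.
  by apply: transfer5 => // x; have [] := parts6 x.
by rewrite parts v1 v3 v5 !addr0.
Qed.

Theorem proposition5p2 (R : realType) (f : tpoly R[i]) :
  @deg_le R[i] 5 f -> satisfies (@V6_op R[i]) f ->
  consequence [:: skew_symmetry R[i]; ternary_derivation R[i]] f.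
Proof. exact: identities_deg_le5. Qed.
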